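(* Relative to the commutative ai-semiring laws, a finite identity basis for the semiring $S_c^*(\{a_1\cdots a_m: m\ge 1\})$ is given by the three identities $$x\preceq xy,\qquad y\preceq x^2,\qquad xyz\approx xy+xz+yz.$$ That is, these three identities hold in $S_c^*(\{a_1\cdots a_m: m\ge 1\})$, and every identity holding in it follows from these three together with the commutative ai-semiring laws.
   Context: An ai-semiring (additively idempotent semiring) is an algebra $(S,+,\cdot)$ with two binary operations such that $(S,+)$ is a commutative idempotent semigroup, $(S,\cdot)$ is a semigroup, and both distributive laws hold. The signature is $(+,\cdot)$, with no constants. The commutative ai-semiring laws are the ai-semiring axioms together with $xy\approx yx$. For terms $\mathbf u,\mathbf v$, the expression $\mathbf u\preceq\mathbf v$ denotes the identity $\mathbf u+\mathbf v\approx\mathbf v$. Let $a_1,a_2,\ldots$ be distinct letters. The semiring $S_c^*(\{a_1\cdots a_m:m\ge1\})$ has as its nonzero elements all nonempty square-free commutative words on $\{a_1,a_2,\ldots\}$ (equivalently, all nonempty finite subsets of the alphabet), together with an element $0$ that is absorbing for both addition and multiplication. For nonzero $u,v$: $u+v$ is the square-free word whose set of letters is the union of the sets of letters of $u$ and $v$; $u\cdot v$ is the square-free word $uv$ if $u$ and $v$ have no letter in common, and $u\cdot v=0$ otherwise. *)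

(* Defs.v *)
From HB Require Import structures.
From mathcomp Require Import all_boot finmap.

Set Implicit Arguments.
Unset Strict Implicit.
Unset Printing Implicit Defensive.

Inductive term : Type :=
| Var of nat
| Add of term & term
| Mul of term & term.

Fixpoint tree_of_term (t : term) : GenTree.tree nat :=
  match t with
  | Var i => GenTree.Leaf i
  | Add u v => GenTree.Node 0 [:: tree_of_term u; tree_of_term v]
  | Mul u v => GenTree.Node 1 [:: tree_of_term u; tree_of_term v]
  end.

Fixpoint term_of_tree (t : GenTree.tree nat) : option term :=
  match t with
  | GenTree.Leaf i => Some (Var i)
  | GenTree.Node k [:: u; v] =>
      match term_of_tree u, term_of_tree v with
      | Some u, Some v => Some (if k is 0 then Add u v else Mul u v)
      | _, _ => None
      end
  | _ => None
  end.

Lemma tree_of_termK : pcancel tree_of_term term_of_tree.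
Proof. by elim=> //= u -> v ->. Qed.

HB.instance Definition _ := Countable.copy term (pcan_type tree_of_termK).

Declare Scope term_scope.
Delimit Scope term_scope with term.
Bind Scope term_scope with term.
Notation "u + v" := (Add u v) : term_scope.
Notation "u * v" := (Mul u v) : term_scope.

Definition identity : Type := (term * term)%type.

Notation "u '≈' v" := ((u%term, v%term) : identity)
  (at level 70, no associativity).
Notation "u '⪯' v" := ((u + v ≈ v)%term)
  (at level 70, no associativity).

Fixpoint subst (s : nat -> term) (t : term) : term :=
  match t with
  | Var i => s i
  | Add u v => Add (subst s u) (subst s v)
  | Mul u v => Mul (subst s u) (subst s v)
  end.

(* Derivability in equational logic (Birkhoff's rules). *)
Inductive derivable (E : seq identity) : term -> term -> Prop :=
| d_axiom e s : e \in E -> derivable E (subst s e.1) (subst s e.2)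
| d_refl t : derivable E t t
| d_sym u v : derivable E u v -> derivable E v u
| d_trans u v w : derivable E u v -> derivable E v w -> derivable E u w
| d_add u u' v v' :
    derivable E u u' -> derivable E v v' -> derivable E (u + v)%term (u' + v')%term
| d_mul u u' v v' :
    derivable E u u' -> derivable E v v' -> derivable E (u * v)%term (u' * v')%term.

Definition follows_from (E : seq identity) (e : identity) : Prop :=
  derivable E e.1 e.2.

Record algebra : Type := Algebra {
  carrier :> Type;
  add : carrier -> carrier -> carrier;
  mul : carrier -> carrier -> carrier
}.

Fixpoint eval (S : algebra) (a : nat -> S) (t : term) : S :=
  match t with
  | Var i => a i
  | Add u v => add (eval a u) (eval a v)
  | Mul u v => mul (eval a u) (eval a v)
  end.

Definition holds_in (S : algebra) (e : identity) : Prop :=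
  forall a : nat -> S, eval a e.1 = eval a e.2.

Definition ai_semiring_laws : seq identity :=
  let x := Var 0 in let y := Var 1 in let z := Var 2 in
  [:: (x + y) + z ≈ x + (y + z);
      x + y ≈ y + x;
      x + x ≈ x;
      (x * y) * z ≈ x * (y * z);
      x * (y + z) ≈ x * y + x * z;
      (x + y) * z ≈ x * z + y * z].

Definition comm_ai_semiring_laws : seq identity :=
  let x := Var 0 in let y := Var 1 in
  rcons ai_semiring_laws (x * y ≈ y * x).

(* The letter a_(i+1) is encoded by i, and a nonempty square-free commutative
   word by its set of letters. *)
Definition word : Type := {w : {fset nat} | w != fset0}.

Lemma fsetU_neq0 (u v : word) : (val u `|` val v)%fset != fset0.
Proof. by rewrite fsetU_eq0 negb_and (valP u). Qed.

Definition union (u v : word) : word := 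
  exist (fun w : {fset nat} => w != fset0) _ (fsetU_neq0 u v).

Definition sc_add (u v : option word) : option word :=
  if (u, v) is (Some u, Some v) then Some (union u v) else None.

Definition sc_mul (u v : option word) : option word :=
  if (u, v) is (Some u, Some v) then
    if [disjoint val u & val v]%fset then Some (union u v) else None
  else None.

(* S_c^*({a_1 ... a_m : m >= 1}); its zero is [None]. *)
Definition Sc_star : algebra := Algebra sc_add sc_mul.

Lemma Sc_star_comm_ai_semiring (e : identity) :
  e \in comm_ai_semiring_laws -> holds_in Sc_star e.
Proof.
have eqU (u v : word) : val u =i val v -> Some u = Some v.
  by move=> /fsetP uv; congr Some; apply: val_inj.
have dU (u v w : word) : [disjoint sval (union u v) & sval w]%fset =
    [disjoint sval u & sval w]%fset && [disjoint sval v & sval w]%fset.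
  exact: fdisjointUX.
have dX (u v w : word) : [disjoint sval u & sval (union v w)]%fset =
    [disjoint sval u & sval v]%fset && [disjoint sval u & sval w]%fset.
  exact: fdisjointXU.
move=> Ee a; move: Ee; rewrite mem_rcons !inE.
case/or4P=> [/eqP->|/eqP->|/eqP->|/or4P[/eqP->|/eqP->|/eqP->|/eqP->]] /=;
  rewrite /sc_add /sc_mul; case: (a 0) => [u|] //; try case: (a 1) => [v|] //;
  try case: (a 2) => [w|] //=; try by case: ifP.
all: try by apply: eqU => i; rewrite !inE; do ?case: (i \in _).
1-2: rewrite fdisjoint_sym; case: ifP => // _.
1-2: by apply: eqU => i; rewrite !inE orbC.
- case uv: [disjoint sval u & sval v]%fset;
    case vw: [disjoint sval v & sval w]%fset => //=;
    rewrite ?dU ?dX ?uv ?vw ?andbF //= andbT.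
  by case: ifP => // _; apply: eqU => i; rewrite !inE orbA.
- rewrite fdisjointXU; do 2!case: [disjoint _ & _]%fset => //=.
  by apply: eqU => i; rewrite !inE; do ?case: (i \in _).
- rewrite fdisjointUX; do 2!case: [disjoint _ & _]%fset => //=.
  by apply: eqU => i; rewrite !inE; do ?case: (i \in _).
Qed.

(* Main.v *)
Require Import Defs.
From mathcomp Require Import all_boot.
From Stdlib Require Import Setoid Morphisms.
From mathcomp Require Import finmap.

(** Attach to a term the set of its variables and the graph (with loops) joining
two variables that occur in a common monomial.  The identities make every term
the least upper bound of its variables and of the products of adjacent
variables; a loop makes it a greatest element, because [y ⪯ x * x].  Conversely,
a valuation by single letters, one of them possibly zero, evaluates to zero
exactly when a variable of the term is sent to zero or two adjacent variables
are identified.  Sending one variable to zero, or identifying two variables, thus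
detects the variables and the edges of a term unless it has a loop. *)

Set Implicit Arguments.
Unset Strict Implicit.
Unset Printing Implicit Defensive.

Local Open Scope term_scope.

(** * Consequences of the identities and the order they define *)

Definition star_laws : seq identity :=
  let x := Var 0 in let y := Var 1 in let z := Var 2 in
  [:: x ⪯ x * y;
      y ⪯ x * x;
      x * y * z ≈ x * y + x * z + y * z].

Definition star_eq : term -> term -> Prop :=
  derivable (comm_ai_semiring_laws ++ star_laws).

Definition star_le (u v : term) : Prop := star_eq (u + v) v.

#[local] Instance star_eq_equivalence : Equivalence star_eq.
Proof.
split; [exact: d_refl | exact: d_sym | exact: d_trans].
Qed.

Lemma star_eq_refl u : star_eq u u.
Proof. exact: d_refl. Qed.

#[local] Hint Resolve star_eq_refl : core.

#[local] Instance star_eq_add : Proper (star_eq ==> star_eq ==> star_eq) Add.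
Proof. by move=> u u' uu' v v' vv'; apply: d_add. Qed.

#[local] Instance star_eq_mul : Proper (star_eq ==> star_eq ==> star_eq) Mul.
Proof. by move=> u u' uu' v v' vv'; apply: d_mul. Qed.

(** Reads off an instance of the identity at position [k] of the list, with [u], [v], [w] in place
    of variables 0, 1, 2. The default [u] in [nth] is never reached for these variables, so each law
    below holds by computation. *)
Lemma star_axiom (k : nat) (u v w : term) :
  let E := comm_ai_semiring_laws ++ star_laws in
  let e := nth (u ≈ u) E k in
  let s := nth u [:: u; v; w] in
  k < size E -> star_eq (subst s e.1) (subst s e.2).
Proof. by move=> E e s kE; apply/d_axiom/mem_nth. Qed.

Lemma star_addA u v w : star_eq (u + v + w) (u + (v + w)).
Proof. exact: (@star_axiom 0 u v w isT). Qed.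

Lemma star_addC u v : star_eq (u + v) (v + u).
Proof. exact: (@star_axiom 1 u v v isT). Qed.

Lemma star_addxx u : star_eq (u + u) u.
Proof. exact: (@star_axiom 2 u u u isT). Qed.

Lemma star_mulDr u v w : star_eq (u * (v + w)) (u * v + u * w).
Proof. exact: (@star_axiom 4 u v w isT). Qed.

Lemma star_mulA u v w : star_eq (u * v * w) (u * (v * w)).
Proof. exact: (@star_axiom 3 u v w isT). Qed.

Lemma star_mulC u v : star_eq (u * v) (v * u).
Proof. exact: (@star_axiom 6 u v v isT). Qed.

Lemma star_le_mulr u v : star_le u (u * v).
Proof. exact: (@star_axiom 7 u v v isT). Qed.

Lemma star_le_square u v : star_le v (u * u).
Proof. exact: (@star_axiom 8 u v v isT). Qed.

Lemma star_mul3 u v w : star_eq (u * v * w) (u * v + u * w + v * w).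
Proof. exact: (@star_axiom 9 u v w isT). Qed.

#[local] Instance star_le_proper :
  Proper (star_eq ==> star_eq ==> iff) star_le.
Proof. by move=> u u' uu' v v' vv'; rewrite /star_le uu' vv'. Qed.

Lemma star_le_refl u : star_le u u.
Proof. exact: star_addxx. Qed.

Lemma star_le_trans v u w : star_le u v -> star_le v w -> star_le u w.
Proof. by rewrite /star_le => uv vw; rewrite -vw -star_addA uv. Qed.

Lemma star_le_anti u v : star_le u v -> star_le v u -> star_eq u v.
Proof. by rewrite /star_le => uv vu; rewrite -vu star_addC uv. Qed.

Lemma star_le_addl u v : star_le u (u + v).
Proof. by rewrite /star_le -star_addA star_addxx. Qed.

Lemma star_le_addr u v : star_le v (u + v).
Proof. by rewrite star_addC; apply: star_le_addl. Qed.

Lemma star_le_add u v w : star_le u w -> star_le v w -> star_le (u + v) w.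
Proof. by rewrite /star_le => uw vw; rewrite star_addA vw. Qed.

Lemma star_le_mull u v : star_le v (u * v).
Proof. by rewrite star_mulC; apply: star_le_mulr. Qed.

Lemma star_le_mul2l w u v : star_le u v -> star_le (w * u) (w * v).
Proof. by rewrite /star_le => uv; rewrite -star_mulDr uv. Qed.

Lemma star_le_mul u u' v v' :
  star_le u u' -> star_le v v' -> star_le (u * v) (u' * v').
Proof.
move=> uu' vv'; apply: (star_le_trans (star_le_mul2l u vv')).
by rewrite (star_mulC u) (star_mulC u'); apply: star_le_mul2l.
Qed.

(** * The graph of a term and the least upper bound property *)

Fixpoint vars (t : term) : seq nat :=
  match t with
  | Var i => [:: i]
  | Add u v | Mul u v => vars u ++ vars v
  end.

(* A loop [adj t x x] means that some monomial of [t] is not square-free. *)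
Fixpoint adj (t : term) (x y : nat) : bool :=
  match t with
  | Var _ => false
  | Add u v => adj u x y || adj v x y
  | Mul u v => [|| adj u x y, adj v x y,
                   (x \in vars u) && (y \in vars v) |
                   (x \in vars v) && (y \in vars u)]
  end.

Lemma star_le_var t x : x \in vars t -> star_le (Var x) t.
Proof.
elim: t => [i|u IHu v IHv|u IHu v IHv] /=.
- by rewrite inE => /eqP->; apply: star_le_refl.
- rewrite mem_cat => /orP[/IHu|/IHv] xt; apply: (star_le_trans xt).
  + exact: star_le_addl.
  + exact: star_le_addr.
- rewrite mem_cat => /orP[/IHu|/IHv] xt; apply: (star_le_trans xt).
  + exact: star_le_mulr.
  + exact: star_le_mull.
Qed.

Lemma star_le_adj t x y : adj t x y -> star_le (Var x * Var y) t.
Proof.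
elim: t => [//|u IHu v IHv|u IHu v IHv] /=.
- case/orP=> [/IHu|/IHv] xyt; apply: (star_le_trans xyt).
  + exact: star_le_addl.
  + exact: star_le_addr.
- case/or4P=> [/IHu|/IHv|/andP[xu yv]|/andP[xv yu]].
  + by move=> xyt; apply: (star_le_trans xyt); apply: star_le_mulr.
  + by move=> xyt; apply: (star_le_trans xyt); apply: star_le_mull.
  + by apply: star_le_mul; apply: star_le_var.
  + by rewrite star_mulC; apply: star_le_mul; apply: star_le_var.
Qed.

Lemma star_le_loop t x u : adj t x x -> star_le u t.
Proof.
by move=> /star_le_adj; apply: star_le_trans; apply: star_le_square.
Qed.

(** Induction on [v]. Sums split by distributivity. A product [v1 * v2] splits by the third identity
    into [u * v1], [u * v2] and [v1 * v2], and the last summand lies below [w] because [v] does. *)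
Lemma star_mul_le_vars u v w :
  star_le v w -> (forall y, y \in vars v -> star_le (u * Var y) w) ->
  star_le (u * v) w.
Proof.
elim: v => [i|v1 IH1 v2 IH2|v1 IH1 v2 IH2] /= vw uw.
- by apply: uw; rewrite inE.
- rewrite star_mulDr; apply: star_le_add.
  + apply: IH1 => [|y y1]; last by apply: uw; rewrite mem_cat y1.
    exact: star_le_trans (star_le_addl v1 v2) vw.
  + apply: IH2 => [|y y2]; last by apply: uw; rewrite mem_cat y2 orbT.
    exact: star_le_trans (star_le_addr v1 v2) vw.
- rewrite -star_mulA star_mul3.
  apply: star_le_add => //; apply: star_le_add.
  + apply: IH1 => [|y y1]; last by apply: uw; rewrite mem_cat y1.
    exact: star_le_trans (star_le_mulr v1 v2) vw.
  + apply: IH2 => [|y y2]; last by apply: uw; rewrite mem_cat y2 orbT.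
    exact: star_le_trans (star_le_mull v1 v2) vw.
Qed.

(** Together with [star_le_var] and [star_le_adj] this makes a term the least upper bound of its
    variables and edges, so that inequalities can be checked on graphs. *)
Lemma star_le_lub u w :
  (forall x, x \in vars u -> star_le (Var x) w) ->
  (forall x y, adj u x y -> star_le (Var x * Var y) w) ->
  star_le u w.
Proof.
elim: u => [i|u IHu v IHv|u IHu v IHv] /= varw adjw.
- by apply: varw; rewrite inE.
- apply: star_le_add.
  + apply: IHu => [x xu|x y xyu]; first by apply: varw; rewrite mem_cat xu.
    by apply: adjw; rewrite xyu.
  + apply: IHv => [x xv|x y xyv].
      by apply: varw; rewrite mem_cat xv orbT.
    by apply: adjw; rewrite xyv orbT.
- have uw : star_le u w.
    apply: IHu => [x xu|x y xyu]; first by apply: varw; rewrite mem_cat xu.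
    by apply: adjw; rewrite xyu.
  have vw : star_le v w.
    apply: IHv => [x xv|x y xyv].
      by apply: varw; rewrite mem_cat xv orbT.
    by apply: adjw; rewrite xyv orbT.
  (* The right factor is broken into variables first, then the left one; what remains is a product
     of two variables joined by an edge of [u * v]. *)
  apply: star_mul_le_vars => // y yv; rewrite star_mulC.
  apply: star_mul_le_vars => // x xu; rewrite star_mulC.
  by apply: adjw; rewrite xu yv !orbT.
Qed.

(** * Valuations by single letters and their zeros *)

Lemma fset1_neq0 (i : nat) : [fset i]%fset != fset0.
Proof. by apply/fset0Pn; exists i; rewrite inE. Qed.

Definition letter (i : nat) : word :=
  exist (fun w : {fset nat} => w != fset0) _ (fset1_neq0 i).

Definition letter_valuation (f : nat -> option nat) (x : nat) : Sc_star :=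
  omap letter (f x).

Definition conflict (f : nat -> option nat) (t : term) : Prop :=
  (exists2 x, x \in vars t & f x = None) \/
  (exists x y, adj t x y /\ f x = f y).

Lemma conflict_add f u v : conflict f (u + v) <-> conflict f u \/ conflict f v.
Proof.
split=> [[[x]|[x [y []]]]|[]] /=.
- by rewrite mem_cat => /orP[xu|xv] fx; [left|right]; left; exists x.
- by case/orP=> [xyu|xyv] fxy; [left|right]; right; exists x, y.
- case=> [[x xu fx]|[x [y [xyu fxy]]]].
    by left; exists x; rewrite //= mem_cat xu.
  by right; exists x, y; rewrite /= xyu.
- case=> [[x xv fx]|[x [y [xyv fxy]]]].
    by left; exists x; rewrite //= mem_cat xv orbT.
  by right; exists x, y; rewrite /= xyv orbT.
Qed.

Lemma conflict_mul f u v :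
  conflict f (u * v) <->
  [\/ conflict f u, conflict f v |
     exists x y, [/\ x \in vars u, y \in vars v & f x = f y]].
Proof.
split=> [[[x]|[x [y []]]]|[]] /=.
- by rewrite mem_cat => /orP[xu|xv] fx;
  [apply: Or31|apply: Or32]; left; exists x.
- case/or4P=> [xyu|xyv|/andP[xu yv]|/andP[xv yu]] fxy.
  + by apply: Or31; right; exists x, y.
  + by apply: Or32; right; exists x, y.
  + by apply: Or33; exists x, y.
  + by apply: Or33; exists y, x.
- case=> [[x xu fx]|[x [y [xyu fxy]]]].
    by left; exists x; rewrite //= mem_cat xu.
  by right; exists x, y; rewrite /= xyu.
- case=> [[x xv fx]|[x [y [xyv fxy]]]].
    by left; exists x; rewrite //= mem_cat xv orbT.
  by right; exists x, y; rewrite /= xyv orbT.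
- by case=> x [y [xu yv fxy]]; right; exists x, y; rewrite /= xu yv !orbT.
Qed.

(** Only the zero criterion is used later, but the induction also needs the letters of a nonzero
    value: in a product they decide whether the two factors are disjoint. *)
Lemma eval_letter_valuation f t :
  if eval (letter_valuation f) t is Some w then
    ~ conflict f t /\
    forall i, (i \in val w) = (Some i \in [seq f x | x <- vars t])
  else conflict f t.
Proof.
elim: t => [i|u IHu v IHv|u IHu v IHv].
- rewrite /= /letter_valuation; case fi: (f i) => [j|] /=.
    split=> [|k]; last by rewrite !inE.
    by case=> [[x]|[x [y []]]] //=; rewrite inE => /eqP->; rewrite fi.
  by left; exists i; rewrite //= inE.
- rewrite /= /sc_add.
  case: (eval _ u) IHu => [w1 [nfu w1E]|fu]; last by apply/conflict_add; left.
  case: (eval _ v) IHv => [w2 [nfv w2E]|fv]; last by apply/conflict_add; right.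
  split=> [/conflict_add[]//|i].
  by rewrite in_fsetU map_cat mem_cat w1E w2E.
- rewrite /= /sc_mul.
  case: (eval _ u) IHu => [w1 [nfu w1E]|fu]; last by apply/conflict_mul/Or31.
  case: (eval _ v) IHv => [w2 [nfv w2E]|fv]; last by apply/conflict_mul/Or32.
  case: ifPn => [/fdisjointP dis|/fset0Pn[i]].
    split=> [|i]; last by rewrite in_fsetU map_cat mem_cat w1E w2E.
    (* A common image of [x] and [y] is either a letter shared by both values, against disjointness,
       or zero, which is already a conflict in [u]. *)
    case/conflict_mul=> // -[x [y [xu yv fxy]]]; case fx: (f x) => [i|].
      have : i \in val w1 by rewrite w1E -fx map_f.
      by move/dis; rewrite w2E -fx fxy map_f.
    by apply: nfu; left; exists x.
  rewrite in_fsetI w1E w2E => /andP[/mapP[x xu fx] /mapP[y yv fy]].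
  by apply/conflict_mul/Or33; exists x, y; rewrite -fx.
Qed.

Lemma eval_conflict f t : eval (letter_valuation f) t = None <-> conflict f t.
Proof.
have := eval_letter_valuation f t.
by case: (eval _ t) => [w [nft _]|ft]; split.
Qed.

(** * From valid identities to derivable inequalities *)

Lemma holds_in_conflict u v f :
  holds_in Sc_star (u ≈ v) -> conflict f u -> conflict f v.
Proof. by move=> uv /eval_conflict; rewrite (uv _) => /eval_conflict. Qed.

Lemma holds_in_star_le u v : holds_in Sc_star (u ≈ v) -> star_le u v.
Proof.
move=> uv; apply: star_le_lub => [x xu|x y xyu].
(* Sending only [x] to zero keeps all other variables distinct, so a conflict in [v] is an
   occurrence of [x] or a loop. *)
- pose f z := if z == x then None else Some z.
  have /(holds_in_conflict uv) : conflict f u.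
    by left; exists x; rewrite // /f eqxx.
  case=> [[z zv]|[p [q [pqv]]]]; rewrite /f.
    by case: eqP zv => // -> /star_le_var.
  case: eqP pqv => [->|_]; case: eqP => [->|_] // pqv.
    by move=> _; apply: star_le_loop pqv.
  by case=> pq; apply: (star_le_loop (x := p)); rewrite {2}pq.
(* Only [x] and [y] are identified and nothing becomes zero, so a conflict in [v] is a loop or the
   edge between [x] and [y], in either orientation. *)
- pose f z := Some (if z == x then y else z).
  have /(holds_in_conflict uv) : conflict f u.
    by right; exists x, y; rewrite /f eqxx; case: eqP => // ->.
  case=> [[z zv]//|[p [q [pqv]]]]; rewrite /f.
  case: eqP pqv => [->|_]; case: eqP => [->|_] // pqv pq.
  + exact: star_le_loop pqv.
  + by case: pq => ->; apply: star_le_adj.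
  + by case: pq => <-; rewrite star_mulC; apply: star_le_adj.
  + by apply: (star_le_loop (x := p)); case: pq => {2}->.
Qed.

(** * Validity of the three identities, and the basis theorem *)

Lemma star_laws_hold e : e \in star_laws -> holds_in Sc_star e.
Proof.
have eqU (u v : word) : val u =i val v -> Some u = Some v.
  by move=> /fsetP uv; congr Some; apply: val_inj.
have dUX (u v w : word) : [disjoint sval (union u v) & sval w]%fset =
    [disjoint sval u & sval w]%fset && [disjoint sval v & sval w]%fset.
  exact: fdisjointUX.
have dxx (u : word) : [disjoint sval u & sval u]%fset = false.
  by apply/negbTE; rewrite /fdisjoint fsetIid (valP u).
(* By [dxx] every square is zero, so both sides of the second identity are zero. *)
move=> Ee a; move: Ee; rewrite !inE => /or3P[] /eqP-> /=;
  rewrite /sc_add /sc_mul;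
  case: (a 0) => [u|] //; case: (a 1) => [v|] //; rewrite ?dxx //.
  by case: ifP => //= _; apply: eqU => i; rewrite !inE orbA orbb.
case: (a 2) => [w|] //=; last by case: ifP.
(* Each side of the third identity is nonzero exactly when the three words are pairwise disjoint,
   and is then their union. *)
case: ifP => //= _; rewrite dUX.
case: [disjoint sval u & sval w]%fset => //=; case: ifP => //= _.
by apply: eqU => i; rewrite !inE; do !case: (i \in _).
Qed.

Theorem theorem5p1 :
  let x := Var 0 in let y := Var 1 in let z := Var 2 in
  let Sigma : seq identity :=
    [:: x ⪯ x * y;
        y ⪯ x * x;
        x * y * z ≈ x * y + x * z + y * z] in
  (forall e : identity, e \in Sigma -> holds_in Sc_star e) /\
  (forall e : identity, holds_in Sc_star e ->
     follows_from (comm_ai_semiring_laws ++ Sigma) e).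
Proof.
split; first exact: star_laws_hold.
(* Validity is symmetric in the two sides, so it yields both inequalities. *)
case=> u v uv; apply: star_le_anti; exact: holds_in_star_le.
Qed.
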